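(* Let $\beta,L,\Lambda,K,\Sigma,\Gamma>0$. Let $u:\mathbb{R}\to\mathbb{R}$ be continuous, supported on $[-1,1]$, with $$\int_{-1}^1 u(t)\,dt=-1,\qquad \int_{-1}^1t^2u(t)\,dt=0,\qquad u(t)=O(|t|^{\beta})\ \text{ as } t\to0,$$ and put $u^h(t)=hu(ht)$. Let $h=h_n=(\eta\log n)^{-1/2}$ with $0<\eta<\Sigma^{-2}$, and let $M_n=m_nh_n^{-2}$ be positive numbers, where $(m_n)$ is a sequence of real numbers diverging to $+\infty$ at a slower rate than $\log n$ (i.e. $m_n=o(\log n)$). Define the estimator $$\tilde\lambda_n=\int_{-1/h}^{1/h}\max\{\min\{M_n,\log(|\phi_{emp}(t)|)\},-M_n\}\,u^h(t)\,dt .$$ Then there exist a constant $A>0$ and an integer $n_0$ such that for all $n\ge n_0$ $$\sup_{|\gamma|\le\Gamma}\ \sup_{\sigma\in(0,\Sigma]}\ \sup_{\rho\in W(\beta,L,\Lambda,K)}\operatorname{E}\bigl[(\tilde\lambda_n-\lambda)^2\bigr]\le A(\log n)^{-\beta-1}.$$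
   Context: For $\gamma\in\mathbb{R}$, $\sigma\ge0$ and a Lévy density $\rho:\mathbb{R}\to[0,\infty)$ with $0<\lambda:=\int_{-\infty}^{\infty}\rho(x)\,dx<\infty$, let $X_1,\dots,X_n$ be i.i.d. copies of a random variable $X$ with characteristic function $$\phi_X(t)=\exp\Bigl[i\gamma t-\tfrac12\sigma^2t^2+\int_{\mathbb{R}}(e^{itx}-1)\rho(x)\,dx\Bigr].$$ Expectations are taken under the law determined by $(\gamma,\sigma^2,\rho)$. Write $f=\rho/\lambda$ (a probability density), $\phi_f(t)=\int e^{itx}f(x)\,dx$, and $\phi_{emp}(t)=\frac1n\sum_{j=1}^n e^{itX_j}$ for the empirical characteristic function. Define $$W(\beta,L,\Lambda,K)=\Bigl\{\rho:\ \rho=\lambda f,\ f\text{ a probability density},\ \int_{-\infty}^{\infty}x^2f(x)\,dx\le K,\ \int_{-\infty}^{\infty}|t|^\beta|\phi_f(t)|\,dt\le L,\ \lambda\in(0,\Lambda]\Bigr\}.$$ Convention: $\log 0=-\infty$, so that the truncated expression equals $-M_n$ where $\phi_{emp}(t)=0$. The constants $A,n_0$ do not depend on $n$ or on $(\gamma,\sigma,\rho)$ in the indicated classes (they may depend on the class parameters, $\eta$, $(m_n)$ and $u$). *)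

(* Defs.v *)
From HB Require Import structures.
From mathcomp Require Export all_boot all_order all_algebra.
From mathcomp Require Export all_classical all_reals all_analysis.
From mathcomp Require Export complex.

Set Implicit Arguments.
Unset Strict Implicit.
Unset Printing Implicit Defensive.

Export Order.TTheory GRing.Theory Num.Theory.
Export numFieldNormedType.Exports.

Local Open Scope classical_set_scope.
Local Open Scope ring_scope.
Local Open Scope complex_scope.

Section complex_valued_functions.
Context {R : realType}.

Definition cexp (z : R[i]) : R[i] :=
  (expR (complex.Re z) * cos (complex.Im z)) +i*
  (expR (complex.Re z) * sin (complex.Im z)).

Definition expi (x : R) : R[i] := cexp (0 +i* x).

Definition cmod (z : R[i]) : R := ComplexField.Normc.normc z.

Definition cintegral d (T : measurableType d) (mu : {measure set T -> \bar R})
    (D : set T) (g : T -> R[i]) : R[i] :=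
  (\int[mu]_(x in D) complex.Re (g x)) +i* (\int[mu]_(x in D) complex.Im (g x)).

End complex_valued_functions.

Section random_variables.
Context {R : realType} {d : measure_display} {T : measurableType d}.
Variable P : probability T R.

Definition char_fun (X : {RV P >-> R}) (t : R) : R[i] :=
  cintegral P [set: T] (fun w => expi (t * X w)).

Definition mutually_independent (n : nat) (X : 'I_n -> {RV P >-> R}) : Prop :=
  forall (J : {set 'I_n}) (B : 'I_n -> set R),
    (forall i, measurable (B i)) ->
    P (\bigcap_(i in [set` J]) (X i @^-1` B i)) =
    (\prod_(i in J) P (X i @^-1` B i))%E.

Definition iid_copies (X : {RV P >-> R}) (n : nat) (Xs : 'I_n -> {RV P >-> R})
    : Prop :=
  mutually_independent Xs /\
  forall (i : 'I_n) (B : set R), measurable B ->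
    distribution P (Xs i) B = distribution P X B.

End random_variables.

Section model.
Context {R : realType}.
Local Notation mu := (@lebesgue_measure R).

Definition phi_levy (gamma sigma : R) (rho : R -> R) (t : R) : R[i] :=
  cexp ((0 +i* (gamma * t)) - (2^-1 * sigma ^+ 2 * t ^+ 2)%:C +
        cintegral mu [set: R] (fun x => (expi (t * x) - 1) * (rho x)%:C)).

Definition intensity (rho : R -> R) : R := \int[mu]_x rho x.

Definition prob_density (f : R -> R) : Prop :=
  [/\ measurable_fun [set: R] f, (forall x, 0 <= f x) &
      (\int[mu]_x (f x)%:E = 1)%E].

Definition phi_density (f : R -> R) (t : R) : R[i] :=
  cintegral mu [set: R] (fun x => expi (t * x) * (f x)%:C).

(* [lambda] is necessarily [intensity rho], since [f] integrates to 1. *)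
Definition W (beta L Lambda K : R) : set (R -> R) :=
  [set rho | exists (lambda : R) (f : R -> R),
    [/\ (forall x, rho x = lambda * f x),
        prob_density f,
        (\int[mu]_x (x ^+ 2 * f x)%:E <= K%:E)%E,
        (\int[mu]_t (`|t| `^ beta * cmod (phi_density f t))%:E <= L%:E)%E &
        0 < lambda <= Lambda] ].

End model.

Section estimator.
Context {R : realType}.
Local Notation mu := (@lebesgue_measure R).

Definition phi_emp (n : nat) (x : 'I_n -> R) (t : R) : R[i] :=
  (n%:R^-1)%:C * \sum_(j < n) expi (t * x j).

(* [lne 0 = -oo], whereas the real-valued [ln 0] is [0]. *)
Definition trunc_log (M r : R) : R :=
  fine (maxe (mine M%:E (lne r%:E)) (- M)%:E).

Definition kernel_scale (u : R -> R) (h t : R) : R := h * u (h * t).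

(* For n <= 1 (eta log n)^{-1/2} is undefined; here it is 0, as [0 `^ (- 2^-1) = 0]. *)
Definition bandwidth (eta : R) (n : nat) : R := (eta * ln n%:R) `^ (- 2^-1).

Definition trunc_level (eta : R) (m : R^nat) (n : nat) : R :=
  m n * bandwidth eta n ^- 2.

Definition lambda_est (u : R -> R) (eta : R) (m : R^nat) (n : nat)
    (x : 'I_n -> R) : R :=
  let h := bandwidth eta n in
  \int[mu]_(t in `[- h^-1, h^-1])
    (trunc_log (trunc_level eta m n) (cmod (phi_emp x t)) * kernel_scale u h t).

End estimator.

(* Main.v *)
From HB Require Import structures.
Require Import Defs.
From mathcomp Require Import measurable_realfun lebesgue_integral_under ring lra.

(** Since [|phi_X t| = expR (- lambda - sigma^2 t^2 / 2 + lambda Re (phi_f t))],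
    the moment conditions on [u] make [\int ln |phi_X| u^h] equal to [lambda] up
    to the bias [lambda \int Re phi_f u^h], which is [O(h^(1 + beta))] because
    [|u s| <= C |s|^beta] for all [s]. For the stochastic part, truncation makes
    [r |-> trunc_log M r] Lipschitz at [b = |phi_X t|] with constant [4 M / b],
    whatever the value of [r]; as [E |phi_emp t - phi_X t|^2 <= 2 / n] and
    [b^-2 = O(n^(eta Sigma^2))] on [|t| <= 1 / h], Cauchy-Schwarz and Tonelli bound
    its mean square by [O(M_n^2 n^(eta Sigma^2 - 1))], which is smaller than any
    power of [1 / ln n]. *)

Set Implicit Arguments.
Unset Strict Implicit.
Unset Printing Implicit Defensive.

Local Open Scope classical_set_scope.
Local Open Scope ring_scope.

(** Since [phi_emp] may vanish, the difference of the plain logarithms need not even be finite,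
    whatever the sample size. Comparing at the deterministic point [b] rather than at [r] gives an
    estimate that holds on every sample path, so no exceptional event is split off and second
    moments suffice. The tuning conditions have separate jobs. On the window, [|ln b|] is at most
    [2 Lambda + Sigma^2 / (2 h^2)], so [m_n -> +oo] eventually puts it below [M_n = m_n / h^2] and
    truncation leaves [ln b] unchanged. [m_n = o(ln n)] makes [M_n] at most [eta (ln n)^2], and
    [eta Sigma^2 < 1] leaves a genuine negative power of [n] that absorbs this polylogarithmic
    factor. The rate is therefore that of the squared bias:
    [h^(2 + 2 beta) = (eta ln n)^(- beta - 1)]. Uniformity over the class holds because the law
    enters the final bounds only through [Lambda], [Sigma] and [L]. *)

Section integration.
Context {R : realType} d (T : measurableType d).
Variable mu : {measure set T -> \bar R}.

(* Unlike [ge0_le_integral], no measurability is required. *)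
Lemma ge0_le_integral_setT (f g : T -> \bar R) :
  (forall x, 0 <= f x)%E -> (forall x, f x <= g x)%E ->
  (\int[mu]_x f x <= \int[mu]_x g x)%E.
Proof.
move=> f0 fg.
have g0 x : (0 <= g x)%E by exact: le_trans (f0 x) (fg x).
rewrite !ge0_integralTE//; apply: le_ereal_sup => _ /= [h hf <-].
by exists h => // x; exact: le_trans (hf x) (fg x).
Qed.

Lemma ge0_le_integral_set (D : set T) (f g : T -> \bar R) :
  (forall x, D x -> 0 <= f x)%E -> (forall x, D x -> f x <= g x)%E ->
  (\int[mu]_(x in D) f x <= \int[mu]_(x in D) g x)%E.
Proof.
move=> f0 fg; rewrite integral_mkcond [leRHS]integral_mkcond.
apply: ge0_le_integral_setT => x; rewrite /patch; case: ifPn => // /set_mem.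
- exact: f0.
- exact: fg.
Qed.

Lemma bounded_integrable (D : set T) (f : T -> R) (b : R) :
  measurable D -> (mu D < +oo)%E -> measurable_fun D f ->
  (forall x, D x -> `|f x| <= b) -> mu.-integrable D (EFin \o f).
Proof.
move=> mD muD mf fb; apply: measurable_bounded_integrable => //.
exists b; split; first exact: num_real.
by move=> y /ltW by_ x Dx; exact: le_trans (fb _ Dx) by_.
Qed.

Lemma Rintegral_sum (D : set T) (I : Type) (s : seq I) (f : I -> T -> R) :
  measurable D -> (forall i, mu.-integrable D (EFin \o f i)) ->
  \int[mu]_(x in D) (\sum_(i <- s) f i x) =
  \sum_(i <- s) \int[mu]_(x in D) f i x.
Proof.
move=> mD intf.
have ints (r : seq I) : mu.-integrable D (EFin \o (fun x => \sum_(i <- r) f i x)).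
  have -> : EFin \o (fun x => \sum_(i <- r) f i x) =
      fun x => (\sum_(i <- r) (f i x)%:E)%E.
    by apply/funext => x /=; rewrite sumEFin.
  by apply: integrable_sum => // i _; exact: intf.
elim: s => [|i s IH].
  rewrite big_nil (_ : (fun x => _) = fun=> 0); last first.
    by apply/funext => x; rewrite big_nil.
  by rewrite Rintegral_cst// mul0r.
rewrite big_cons -IH -RintegralD//.
by apply: eq_Rintegral => x _; rewrite big_cons.
Qed.

(* Expand [0 <= \int (g - mean g)^2]. *)
Lemma sqr_Rintegral_le (D : set T) (g : T -> R) (b : R) :
  measurable D -> (mu D < +oo)%E -> measurable_fun D g ->
  (forall x, D x -> `|g x| <= b) ->
  (\int[mu]_(x in D) g x) ^+ 2 <= fine (mu D) * \int[mu]_(x in D) g x ^+ 2.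
Proof.
move=> mD muD mg gb.
have intg : mu.-integrable D (EFin \o g) by exact: bounded_integrable gb.
have mg2 : measurable_fun D (fun x => g x ^+ 2) by exact: measurable_funX.
have intg2 : mu.-integrable D (EFin \o (fun x => g x ^+ 2)).
  apply: (@bounded_integrable _ _ (b ^+ 2)) => // x Dx.
  by rewrite normrX ler_sqr ?nnegrE// ?gb// (le_trans _ (gb _ Dx)).
set J := \int[mu]_(x in D) g x; set l := fine (mu D).
have l0 : 0 <= l by rewrite fine_ge0.
have intc (r : R) : mu.-integrable D (EFin \o cst r).
  by apply: (@bounded_integrable _ _ `|r|).
(* The integral of [(g - a)^2] is a nonnegative quadratic in [a]; its minimiser [a = J / l] gives
   the claim. *)
have key (a : R) : 0 <= \int[mu]_(x in D) g x ^+ 2 - 2 * a * J + a ^+ 2 * l.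
  have -> : \int[mu]_(x in D) g x ^+ 2 - 2 * a * J + a ^+ 2 * l =
      \int[mu]_(x in D) (g x ^+ 2 - 2 * a * g x + a ^+ 2).
    rewrite RintegralD//=; first last.
    - exact: intc.
    - have -> : EFin \o (fun x => g x ^+ 2 - 2 * a * g x) =
        (fun x => (g x ^+ 2)%:E - (2 * a)%:E * (g x)%:E)%E by [].
      by apply: integrableB => //; apply: integrableZl.
    rewrite Rintegral_cst// RintegralB//; last first.
      have -> : EFin \o (fun x => 2 * a * g x) =
        (fun x => (2 * a)%:E * (g x)%:E)%E by [].
      by apply: integrableZl.
    by rewrite RintegralZl.
  apply: Rintegral_ge0 => x _.
  have -> : g x ^+ 2 - 2 * a * g x + a ^+ 2 = (g x - a) ^+ 2 by ring.
  exact: sqr_ge0.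
(* The minimiser is undefined when [l = 0]; then [D] is a null set and [J] vanishes. *)
have [l00|lN0] := eqVneq l 0.
  have muD0 : mu D = 0%E.
    by rewrite -[mu D]fineK -/l ?l00// ge0_fin_numE.
  have -> : J = 0.
    by rewrite /J /Rintegral null_set_integral//; exact/measurable_EFinP.
  by rewrite l00 expr0n/= mul0r.
have {}l0 : 0 < l by rewrite lt_def lN0.
have := key (J / l).
rewrite -(pmulr_rge0 _ l0).
have -> : l * (\int[mu]_(x in D) g x ^+ 2 - 2 * (J / l) * J + (J / l) ^+ 2 * l) =
  l * \int[mu]_(x in D) g x ^+ 2 - J ^+ 2 by field.
by rewrite subr_ge0.
Qed.

End integration.

(** * The complex modulus in real coordinates *)

Section complex_modulus.
Context {R : realType}.

Lemma cmod_cexp (z : R[i]) : cmod (cexp z) = expR (complex.Re z).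
Proof.
rewrite /cmod /cexp /=.
rewrite !exprMn -mulrDr cos2Dsin2 mulr1 sqrtr_sqr ger0_norm//.
Qed.

Lemma expiE (x : R) : expi x = (cos x +i* sin x)%C.
Proof. by rewrite /expi /cexp/= expR0 !mul1r. Qed.

Lemma cmod_ge0 (z : R[i]) : 0 <= cmod z.
Proof. by case: z => a b; exact: sqrtr_ge0. Qed.

Lemma sqr_cmod (z : R[i]) :
  cmod z ^+ 2 = complex.Re z ^+ 2 + complex.Im z ^+ 2.
Proof. by case: z => a b; rewrite /cmod/= sqr_sqrtr// addr_ge0// sqr_ge0. Qed.

Lemma normr_Re_le_cmod (z : R[i]) : `|complex.Re z| <= cmod z.
Proof.
rewrite -(ler_pXn2r (n := 2))// ?nnegrE ?cmod_ge0//.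
by rewrite real_normK ?num_real// sqr_cmod lerDl sqr_ge0.
Qed.

(** Reverse triangle inequality, squared. The right-hand side stays in coordinates because the
    cosine and sine parts of [phi_emp] are later treated as two separate real empirical means. *)
Lemma sqr_cmodB_le (z w : R[i]) :
  (cmod z - cmod w) ^+ 2 <=
  (complex.Re z - complex.Re w) ^+ 2 + (complex.Im z - complex.Im w) ^+ 2.
Proof.
suff : complex.Re z * complex.Re w + complex.Im z * complex.Im w <=
    cmod z * cmod w.
  have := sqr_cmod z; have := sqr_cmod w; nra.
apply: le_trans (ler_norm _) _.
rewrite -(ler_pXn2r (n := 2))// ?nnegrE ?mulr_ge0 ?cmod_ge0//.
rewrite real_normK ?num_real// exprMn !sqr_cmod.
set a := complex.Re z; set b := complex.Im z.
set x := complex.Re w; set y := complex.Im w.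
(* Lagrange's identity: this square is the gap in the Cauchy-Schwarz inequality of the plane. *)
have := sqr_ge0 (a * y - b * x); nra.
Qed.

End complex_modulus.

(** * The truncated logarithm as a real logarithm of a clamped argument *)

Section truncated_logarithm.
Context {R : realType}.
Implicit Types M r a : R.

(** Truncation is moved inside the logarithm: the argument is always positive, so the real [ln] can
    be used and its default value at 0 never occurs. *)
Definition clamp M r : R := Num.max (expR (- M)) (Num.min (expR M) r).

Lemma clamp_gt0 M r : 0 < clamp M r.
Proof. by rewrite lt_max expR_gt0. Qed.

(** For [r <= 0] the extended logarithm is [-oo] and truncates to [- M], which is the logarithm of
    the lower clamp [expR (- M)]; elsewhere [ln] is monotone and commutes with [min] and [max]. *)
Lemma trunc_logE M r : 0 <= M -> trunc_log M r = ln (clamp M r).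
Proof.
move=> M0; rewrite /trunc_log /clamp.
have eM : expR (- M) <= expR M by rewrite ler_expR; lra.
have [r0|r0] := leP r 0.
  rewrite le0_lneNy ?lee_fin//.
  rewrite [mine _ _]min_r ?leNye// max_r ?leNye//=.
  rewrite min_r ?(le_trans r0) ?expR_ge0// max_l ?expRK//.
  by rewrite (le_trans r0)// expR_ge0.
rewrite lne_EFin// -EFin_min -EFin_max/=.
have [lM|lM] := leP M (ln r).
  have eMr : expR M <= r by rewrite -[r]lnK ?posrE// ler_expR.
  by rewrite (min_l eMr) (max_r eM) expRK max_l//; lra.
have eMr : r <= expR M by rewrite -[r]lnK ?posrE// ler_expR ltW.
rewrite (min_r eMr).
have [lM'|lM'] := leP (- M) (ln r).
  by rewrite [Num.max (expR _) _]max_r// -[r in _ <= r]lnK ?posrE// ler_expR.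
by rewrite [Num.max (expR _) _]max_l ?expRK// -[r in r <= _]lnK ?posrE// ler_expR ltW.
Qed.

Lemma trunc_log_bound M r : 0 <= M -> `|trunc_log M r| <= M.
Proof.
move=> M0; rewrite trunc_logE// ler_norml /clamp.
have eM : expR (- M) <= expR M by rewrite ler_expR; lra.
apply/andP; split.
  rewrite -[leLHS]expRK ler_ln ?posrE ?expR_gt0 ?clamp_gt0//.
  by rewrite le_max lexx.
rewrite -[leRHS]expRK ler_ln ?posrE ?expR_gt0 ?clamp_gt0//.
by rewrite ge_max eM ge_min lexx.
Qed.

Lemma measurable_trunc_log M : 0 <= M ->
  measurable_fun [set: R] (trunc_log M).
Proof.
move=> M0; rewrite (_ : trunc_log M = @ln R \o clamp M); last first.
  by apply/funext => r /=; rewrite trunc_logE.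
apply: measurableT_comp; first exact: measurable_ln.
by apply: measurable_maxr => //; apply: measurable_minr.
Qed.

(** For [x <= y], apply [ln (1 + z) <= z] to [z = (y - x) / x]. *)
Lemma ln_lipschitz (m x y : R) : 0 < m -> m <= x -> m <= y ->
  `|ln x - ln y| <= `|x - y| / m.
Proof.
move=> m0; wlog xy : x y / x <= y.
  move=> H mx my; have [xy|/ltW xy] := leP x y; first exact: H.
  by rewrite distrC (distrC x); exact: H.
move=> mx my.
have x0 : 0 < x by lra.
have y0 : 0 < y by lra.
rewrite distrC (distrC x) !ger0_norm ?subr_ge0 ?ler_ln//.
rewrite -ln_div ?posrE//.
have -> : y / x = 1 + (y - x) / x by field; rewrite gt_eqF.
apply: le_trans (le_ln1Dx _) _.
  by apply: lt_le_trans (_ : 0 <= _); [lra|rewrite divr_ge0//; lra].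
apply: ler_wpM2l; first by rewrite subr_ge0.
by rewrite lef_pV2 ?posrE.
Qed.
End truncated_logarithm.

Lemma bounded_integrable_probability {R : realType} d {T : measurableType d} (P : probability T R)
    (f : T -> R) (b : R) :
  measurable_fun [set: T] f -> (forall w, `|f w| <= b) ->
  P.-integrable [set: T] (EFin \o f).
Proof.
move=> mf fb; apply: (@bounded_integrable _ _ _ _ _ _ b) => //=.
by rewrite (le_lt_trans (probability_le1 P measurableT))// ltry.
Qed.

(** * Independence, equality of laws, and the variance of an empirical mean *)

Section bounded_statistics.
Context {R : realType} d {T : measurableType d} (P : probability T R).
Implicit Types (X Y : {RV P >-> R}) (g k : R -> R).

Lemma Rintegral_indep_mul X Y g k (b : R) :
  (forall A B, measurable A -> measurable B ->
    P (X @^-1` A `&` Y @^-1` B) = (P (X @^-1` A) * P (Y @^-1` B))%E) ->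
  measurable_fun [set: R] g -> measurable_fun [set: R] k ->
  (forall x, `|g x| <= b) -> (forall x, `|k x| <= b) ->
  \int[P]_w (g (X w) * k (Y w)) = \int[P]_w g (X w) * \int[P]_w k (Y w).
Proof.
move=> XY mg mk gb kb.
have b0 : 0 <= b by rewrite (le_trans _ (gb 0)).
have mX : measurable_fun [set: T] X by [].
have mY : measurable_fun [set: T] Y by [].
pose Z w := (X w, Y w).
have mZ : measurable_fun [set: T] Z by exact: measurable_fun_pair.
pose Zmixin := isMeasurableFun.Build _ _ _ _ Z mZ.
pose Zpack : {mfun T >-> (R * R)%type} :=
  HB.pack Z Zmixin.
pose f (z : R * R) : \bar R := (g z.1 * k z.2)%:E.
have mf : measurable_fun [set: R * R] f.
  apply/measurable_EFinP; apply: measurable_funM.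
  - exact: (measurableT_comp mg measurable_fst).
  - exact: (measurableT_comp mk measurable_snd).
(* The hypothesis covers rectangles only; uniqueness of the product measure identifies the joint law
   with the product of the marginals, so that Fubini applies. *)
have ZE (A : set (R * R)) : measurable A ->
    (distribution P X \x distribution P Y)%E A = distribution P Zpack A.
  apply: product_measure_unique => A1 A2 mA1 mA2.
  exact: XY.
have intgX : P.-integrable [set: T] (EFin \o (g \o X)).
  apply: (@bounded_integrable_probability _ _ _ _ _ b) => // [|w].
  - exact: (measurableT_comp mg mX).
  - exact: gb.
have intkY : P.-integrable [set: T] (EFin \o (k \o Y)).
  apply: (@bounded_integrable_probability _ _ _ _ _ b) => // [|w].
  - exact: (measurableT_comp mk mY).
  - exact: kb.
have gkb x y : `|g x * k y| <= b * b by rewrite normrM ler_pM.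
transitivity (fine (\int[distribution P X \x distribution P Y]_z f z)%E).
  rewrite /Rintegral; congr fine.
  rewrite (eq_measure_integral (distribution P Zpack))/=; last first.
    by move=> A mA _; exact: ZE.
  rewrite integral_distribution//=.
  apply: (@bounded_integrable_probability _ _ _ _ _ (b * b)) => //.
  apply/measurable_EFinP; exact: (measurableT_comp mf mZ).
rewrite -fubini1; last first.
  apply: (bounded_integrable_probability (distribution P X \x distribution P Y)%E
     (b := b * b)) => [|z].
  - exact/measurable_EFinP.
  - exact: gkb.
rewrite /fubini_F/=.
have EY : (\int[distribution P Y]_y (k y)%:E = (\int[P]_w k (Y w))%R%:E)%E.
  rewrite integral_distribution//; last exact/measurable_EFinP.
  by rewrite /Rintegral fineK// integrable_fin_num.
have kint : (distribution P Y).-integrable setT (EFin \o k).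
  by apply: (integrable_pushforward mY) => //; exact/measurable_EFinP.
under eq_integral.
  move=> x _; under eq_integral do rewrite /f/= EFinM.
  rewrite integralZl// EY; over.
rewrite integralZr//; last first.
  by apply: (integrable_pushforward mX) => //; exact/measurable_EFinP.
rewrite integral_distribution//; last exact/measurable_EFinP.
by rewrite fineM// integrable_fin_num.
Qed.

Lemma Rintegral_same_law X Y g (b : R) :
  (forall B, measurable B -> distribution P Y B = distribution P X B) ->
  measurable_fun [set: R] g -> (forall x, `|g x| <= b) ->
  \int[P]_w g (Y w) = \int[P]_w g (X w).
Proof.
move=> XY mg gb.
have intg (Z : {RV P >-> R}) : P.-integrable [set: T] (EFin \o g \o Z).
  apply: (@bounded_integrable_probability _ _ _ _ (g \o Z) b) => // [|w].
  - by apply: measurableT_comp.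
  - exact: gb.
have mg' : measurable_fun [set: R] (EFin \o g) by exact/measurable_EFinP.
rewrite /Rintegral; congr fine.
rewrite -[LHS](integral_distribution mg' (intg Y)).
rewrite -[RHS](integral_distribution mg' (intg X)).
by apply: eq_measure_integral => A mA _; exact: XY.
Qed.

(** Expanding the square of the centred sum leaves only the diagonal: the [n] variances are at most
    1 and the covariances vanish. It is applied with [g] a cosine or a sine of [t * x]. *)
Lemma empirical_mean_variance X (n : nat) (Xs : 'I_n -> {RV P >-> R}) g :
  (0 < n)%N -> iid_copies X Xs ->
  measurable_fun [set: R] g -> (forall x, `|g x| <= 1) ->
  \int[P]_w (n%:R^-1 * (\sum_(j < n) g (Xs j w)) - \int[P]_w g (X w)) ^+ 2
    <= n%:R^-1.
Proof.
move=> n0 [indep same] mg g1.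
set a := \int[P]_w g (X w).
have nR0 : n%:R != 0 :> R by rewrite pnatr_eq0 -lt0n.
have mgX j : measurable_fun [set: T] (fun w => g (Xs j w)).
  by apply: (measurableT_comp mg).
have intgX j : P.-integrable [set: T] (EFin \o (fun w => g (Xs j w))).
  by apply: (@bounded_integrable_probability _ _ _ _ _ 1).
have intc (r : R) : P.-integrable [set: T] (EFin \o cst r).
  by apply: (@bounded_integrable_probability _ _ _ _ _ `|r|).
have cstE (r : R) : \int[P]_w r = r.
  rewrite Rintegral_cst// -[RHS]mulr1; congr (_ * _).
    exact: (congr1 fine (probability_setT P)).
have EgX j : \int[P]_w g (Xs j w) = a.
  by apply: (@Rintegral_same_law _ _ _ 1) => // B mB; exact: same.
have a1 : `|a| <= 1.
  rewrite -(EgX (Ordinal n0)); apply: le_trans (le_normr_Rintegral _ _) _ => //.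
  rewrite -[leRHS]cstE; apply: le_Rintegral => //.
  - exact: integrable_norm.
  - exact: intc.
pose Y j w := g (Xs j w) - a.
have mY j : measurable_fun [set: T] (Y j) by exact: measurable_funB.
have Y2 j w : `|Y j w| <= 2.
  exact: le_trans (ler_normB _ _) (lerD (g1 _) a1).
have intYY i j : P.-integrable [set: T] (EFin \o (fun w => Y i w * Y j w)).
  apply: (@bounded_integrable_probability _ _ _ _ _ (2 * 2)) => //.
  - exact: measurable_funM.
  - by move=> w; rewrite normrM ler_pM.
have EYY i j : \int[P]_w (Y i w * Y j w) =
    \int[P]_w (g (Xs i w) * g (Xs j w)) - a ^+ 2.
  have intgg : P.-integrable [set: T]
      (EFin \o (fun w => g (Xs i w) * g (Xs j w))).
    apply: (@bounded_integrable_probability _ _ _ _ _ (1 * 1)) => //.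
    - exact: measurable_funM.
    - by move=> w; rewrite normrM ler_pM.
  have intZ (l : 'I_n) : P.-integrable [set: T]
      (EFin \o (fun w => a * g (Xs l w))).
    apply: (@bounded_integrable_probability _ _ _ _ _ (1 * 1)) => //.
    - exact: measurable_funM.
    - by move=> w; rewrite normrM ler_pM.
  transitivity (\int[P]_w (g (Xs i w) * g (Xs j w)
      - a * g (Xs i w) - a * g (Xs j w) + a ^+ 2)).
    by apply: eq_Rintegral => w _; rewrite /Y; ring.
  have intB (f h : T -> R) : P.-integrable setT (EFin \o f) ->
     P.-integrable setT (EFin \o h) ->
     P.-integrable setT (EFin \o (fun w => f w - h w)).
    by move=> ? ?; apply: (@integrableB _ _ _ P _ _ (EFin \o f) (EFin \o h)).
  rewrite RintegralD//; [|by do 2 apply: (intB) => //|exact: intc].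
  rewrite RintegralB//; last exact: intB.
  rewrite RintegralB// cstE !RintegralZl// !EgX; ring.
have EYYneq i j : i != j -> \int[P]_w (Y i w * Y j w) = 0.
  move=> ij; rewrite EYY (@Rintegral_indep_mul _ _ _ _ 1)// ?EgX; first by ring.
  move=> A B mA mB.
  (* Pairwise independence is extracted from mutual independence at the index set [{i, j}]; the
     values of [C] at other indices do not enter the intersection. *)
  pose C l := if l == i then A else B.
  have := indep [set i; j]%SET C.
  rewrite big_setU1 ?inE// big_set1 /C eqxx eq_sym (negbTE ij) => <-.
    congr (P _).
    apply/seteqP; split => w /=.
    - move=> [Aw Bw] l /=; rewrite !inE => /orP[/eqP->|/eqP->].
        by rewrite eqxx.
      by rewrite eq_sym (negbTE ij).
    - move=> H; split.
      + by have := H i; rewrite /= !inE eqxx; apply.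
      + by have := H j; rewrite /= !inE eqxx orbT eq_sym (negbTE ij); apply.
  by move=> l; case: ifP.
have EYYeq i : \int[P]_w (Y i w * Y i w) <= 1.
  rewrite EYY.
  have : \int[P]_w (g (Xs i w) * g (Xs i w)) <= 1.
    rewrite -[leRHS]cstE; apply: le_Rintegral => //; last 2 first.
    - exact: intc.
    - by move=> w _; apply: le_trans (ler_norm _) _; rewrite normrM mulr_ile1.
    apply: (@bounded_integrable_probability _ _ _ _ _ (1 * 1)) => //.
    - exact: measurable_funM.
    - by move=> w; rewrite normrM ler_pM.
  have := sqr_ge0 a; lra.
have -> : \int[P]_w (n%:R^-1 * (\sum_(j < n) g (Xs j w)) - a) ^+ 2 =
    \int[P]_w (n%:R^-2 * \sum_(i < n) \sum_(j < n) Y i w * Y j w).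
  apply: eq_Rintegral => w _.
  have -> : n%:R^-1 * (\sum_(j < n) g (Xs j w)) - a =
      n%:R^-1 * \sum_(j < n) Y j w.
    rewrite /Y sumrB sumr_const card_ord -[a *+ n]mulr_natl; by field.
  rewrite exprMn exprVn; congr (_ * _).
  rewrite expr2 mulr_suml; apply: eq_bigr => i _.
  by rewrite mulr_sumr.
have intsum (I : finType) (F : I -> T -> R) :
    (forall i, P.-integrable setT (EFin \o F i)) ->
    P.-integrable setT (EFin \o (fun w => \sum_i F i w)).
  move=> iF.
  have -> : EFin \o (fun w => \sum_i F i w) = fun w => (\sum_i (F i w)%:E)%E.
    by apply/funext => w /=; rewrite sumEFin.
  by apply: integrable_sum => // i _; exact: iF.
rewrite RintegralZl//; last first.
  by apply: (intsum _ (fun i w => \sum_(j < n) Y i w * Y j w)) => i; exact: intsum.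
rewrite Rintegral_sum//; last by move=> i; exact: intsum.
have -> : \sum_(i < n) \int[P]_w (\sum_(j < n) Y i w * Y j w) =
    \sum_(i < n) \int[P]_w (Y i w * Y i w).
  apply: eq_bigr => i _; rewrite Rintegral_sum// (bigD1 i)//= big1 ?addr0//.
  by move=> j ji; rewrite EYYneq// eq_sym.
(* The target is written as [n] diagonal terms of size 1, to be compared term by term. *)
have -> : n%:R^-1 = n%:R^-2 * (\sum_(i < n) 1) :> R.
  by rewrite sumr_const card_ord; by field.
apply: ler_wpM2l; first by rewrite invr_ge0 exprn_ge0.
by apply: ler_sum => i _; exact: EYYeq.
Qed.

End bounded_statistics.

Lemma Re_char_fun {R : realType} d {T : measurableType d} (P : probability T R)
    (X : {RV P >-> R}) t :
  complex.Re (char_fun X t) = \int[P]_w cos (t * X w).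
Proof. by apply: eq_Rintegral => w _; rewrite expiE. Qed.

Lemma Im_char_fun {R : realType} d {T : measurableType d} (P : probability T R)
    (X : {RV P >-> R}) t :
  complex.Im (char_fun X t) = \int[P]_w sin (t * X w).
Proof. by apply: eq_Rintegral => w _; rewrite expiE. Qed.

(** * Coordinates and measurability in [t] of the empirical characteristic function *)

Section empirical_characteristic_function.
Context {R : realType} (n : nat).
Implicit Types (x : 'I_n -> R) (t : R).

Lemma phi_empE x t : phi_emp x t =
  ((n%:R^-1 * \sum_(j < n) cos (t * x j)) +i*
   (n%:R^-1 * \sum_(j < n) sin (t * x j)))%C.
Proof.
have sumE (I : Type) (s : seq I) (F G : I -> R) :
    (\sum_(i <- s) (F i +i* G i)%C) =
    ((\sum_(i <- s) F i) +i* (\sum_(i <- s) G i))%C.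
  elim: s => [|i s IH]; first by rewrite !big_nil.
  by rewrite !big_cons IH.
rewrite /phi_emp; under eq_bigr do rewrite expiE.
by rewrite sumE; simpc.
Qed.

Lemma measurable_cmod_phi_emp x :
  measurable_fun [set: R] (fun t => cmod (phi_emp x t)).
Proof.
rewrite (_ : (fun t => _) = fun t =>
  Num.sqrt ((n%:R^-1 * \sum_(j < n) cos (t * x j)) ^+ 2 +
            (n%:R^-1 * \sum_(j < n) sin (t * x j)) ^+ 2)); last first.
  by apply/funext => t; rewrite phi_empE.
apply: (@measurableT_comp _ _ _ _ _ _ (@Num.sqrt R)).
  by apply: continuous_measurable_fun; exact: sqrt_continuous.
have mM (a : R) : measurable_fun [set: R] (fun t : R => t * a) by exact: measurable_funM.
by apply: measurable_funD; apply: measurable_funX; apply: measurable_funM => //;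
  apply: measurable_sum => j; apply: (measurableT_comp _ (mM (x j)));
  apply: continuous_measurable_fun; [exact: continuous_cos|exact: continuous_sin].
Qed.

End empirical_characteristic_function.

(** * The jump density and the modulus of the characteristic function *)

Section compound_poisson.
Context {R : realType}.
Local Notation mu := (@lebesgue_measure R).
Implicit Types f rho : R -> R.

Lemma prob_density_integrable f : prob_density f ->
  mu.-integrable [set: R] (EFin \o f).
Proof.
move=> [mf f0 f1]; apply/integrableP; split; first exact/measurable_EFinP.
under eq_integral do rewrite /= ger0_norm//.
by rewrite f1 ltry.
Qed.

Lemma measurable_cosM (t : R) : measurable_fun [set: R] (fun x => cos (t * x)).
Proof.
apply: (@measurableT_comp _ _ _ _ _ _ (@cos R)).
  by apply: continuous_measurable_fun; exact: continuous_cos.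
exact: measurable_funM.
Qed.

Lemma cos_density_integrable f t : prob_density f ->
  mu.-integrable [set: R] (EFin \o (fun x => cos (t * x) * f x)).
Proof.
move=> fd; have [mf f0 f1] := fd.
apply: (le_integrable measurableT _ _ (prob_density_integrable fd)).
  by apply/measurable_EFinP; apply: measurable_funM => //; exact: measurable_cosM.
move=> x _ /=; rewrite lee_fin normrM ler_piMl//.
by rewrite ler_norml cos_geN1 cos_le1.
Qed.

Lemma Re_phi_density f t :
  complex.Re (phi_density f t) = \int[mu]_x (cos (t * x) * f x).
Proof. by apply: eq_Rintegral => x _; rewrite expiE /= mulr0 subr0. Qed.

Lemma Rintegral_prob_density f : prob_density f -> \int[mu]_x f x = 1.
Proof. by case=> _ _ f1; rewrite /Rintegral f1. Qed.

Lemma normr_Re_phi_density_le1 f t : prob_density f ->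
  `|complex.Re (phi_density f t)| <= 1.
Proof.
move=> fd; have [mf f0 f1] := fd; rewrite Re_phi_density.
have intc := cos_density_integrable t fd.
apply: le_trans (le_normr_Rintegral _ intc) _ => //.
rewrite -(Rintegral_prob_density fd); apply: le_Rintegral => //.
- exact: integrable_norm.
- exact: prob_density_integrable.
- move=> x _; rewrite normrM (ger0_norm (f0 x)) ler_piMl//.
  by rewrite ler_norml cos_geN1 cos_le1.
Qed.

(** Measurability comes from continuity in [t], by dominated convergence with dominating function
    [f]. *)
Lemma measurable_Re_phi_density f : prob_density f ->
  measurable_fun [set: R] (fun t => complex.Re (phi_density f t)).
Proof.
move=> fd; have [mf f0 f1] := fd.
rewrite (_ : (fun t => _) = fun t => \int[mu]_x (cos (t * x) * f x)); last first.
  by apply/funext => t; rewrite Re_phi_density.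
apply: continuous_measurable_fun => t.
apply: (@continuity_under_integral R _ _ mu (fun t x => cos (t * x) * f x)
    setT measurableT (t - 1) (t + 1) _ _ f).
- by move=> s _; exact: cos_density_integrable.
- apply: aeW => y _ s _.
  apply: cvgM; last exact: cvg_cst.
  apply: continuous_comp; last exact: continuous_cos.
  by apply: cvgM; [exact: cvg_id|exact: cvg_cst].
- exact: prob_density_integrable.
- move=> s _; apply: aeW => y _.
  rewrite normrM (ger0_norm (f0 y)) ler_piMl//.
  by rewrite ler_norml cos_geN1 cos_le1.
- by rewrite inE/= in_itv/=; apply/andP; split; lra.
Qed.

Lemma intensityE rho f (lambda : R) : (forall x, rho x = lambda * f x) ->
  prob_density f -> intensity rho = lambda.
Proof.
move=> rhoE fd; rewrite /intensity; under eq_Rintegral do rewrite rhoE.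
rewrite RintegralZl//; last exact: prob_density_integrable.
by rewrite Rintegral_prob_density ?mulr1.
Qed.

(** The modulus of [cexp] sees only the real part of the exponent: the drift is pure phase, and the
    jump integral contributes [lambda * (Re phi_f - 1)]. *)
Lemma cmod_phi_levy gamma sigma rho f (lambda t : R) :
  (forall x, rho x = lambda * f x) -> prob_density f ->
  cmod (phi_levy gamma sigma rho t) =
  expR (- lambda - 2^-1 * sigma ^+ 2 * t ^+ 2 +
        lambda * complex.Re (phi_density f t)).
Proof.
move=> rhoE fd; rewrite /phi_levy cmod_cexp; congr expR.
rewrite Re_phi_density /=.
have -> : \int[mu]_x complex.Re ((expi (t * x) - 1) * (rho x)%:C)%C =
    lambda * \int[mu]_x (cos (t * x) * f x) - lambda.
  transitivity (\int[mu]_x (lambda * (cos (t * x) * f x) - lambda * f x)).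
    by apply: eq_Rintegral => x _; rewrite expiE rhoE /=; ring.
  have ic := cos_density_integrable t fd.
  have ifd := prob_density_integrable fd.
  have iZ (g : R -> R) : mu.-integrable setT (EFin \o g) ->
     mu.-integrable setT (EFin \o (fun x => lambda * g x)).
    by move=> ?; apply: (@integrableZl _ _ _ mu _ _ _ (EFin \o g)).
  rewrite RintegralB//; [|exact: (iZ _ ic)|exact: (iZ _ ifd)].
  by rewrite !RintegralZl// (Rintegral_prob_density fd) mulr1.
ring.
Qed.

End compound_poisson.

(** * Global growth bound and moments of the rescaled kernel *)

Section kernel.
Context {R : realType}.
Local Notation mu := (@lebesgue_measure R).
Implicit Types (u G : R -> R) (h : R).

(** Three ranges of [t] are glued: the O-condition within distance [e] of 0, the maximum of [|u|] on
    [[-1, 1]] divided by [e ^ beta] beyond [e], and the support condition outside [[-1, 1]]. A bound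
    valid everywhere is what lets the bias integral run over a window growing with [n]. *)
Lemma kernel_bound u beta : 0 < beta -> continuous u ->
  (forall t, 1 < `|t| -> u t = 0) ->
  (u : R -> R^o) =O_ (0 : R) (fun t : R => `|t| `^ beta : R^o) ->
  exists2 C : R, 0 < C & forall t, `|u t| <= C * `|t| `^ beta.
Proof.
move=> beta0 uc us /eqOP uO.
have [k [k0 kO]] : exists k : R, 0 < k /\
    \forall t \near (0 : R), `|u t| <= k * `|t| `^ beta.
  near (pinfty_nbhs R) => k.
  exists k; split; first by near: k; exact: nbhs_pinfty_gt.
  have : \forall x \near (0:R), `|u x| <= k * Num.norm (Num.norm x `^ beta).
    by near: k; exact: uO.
  by apply: filterS => x; rewrite (ger0_norm (powR_ge0 _ _)).
have [e /= e0 ke] := (@nbhs_ballP _ _ _ _).1 kO.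
have [c _ ucmax] : exists2 c, c \in `[(-1 : R), 1]
    & forall t, t \in `[(-1 : R), 1] -> `|u t| <= `|u c|.
  apply: EVT_max; first by lra.
  apply: continuous_subspaceT => x; apply: continuous_comp; first exact: uc.
  exact: norm_continuous.
have eb0 : 0 < e `^ beta by rewrite powR_gt0.
exists (k + `|u c| / e `^ beta).
  by rewrite ltr_pwDl// divr_ge0// ltW.
move=> t; rewrite mulrDl.
have [te|et] := ltP `|t| e.
  apply: (le_trans (ke t _)).
    by rewrite /ball/= sub0r normrN.
  by rewrite lerDl mulr_ge0 ?powR_ge0// divr_ge0// ltW.
apply: (@le_trans _ _ (`|u c| / e `^ beta * `|t| `^ beta)); last first.
  by rewrite lerDr mulr_ge0 ?powR_ge0// ltW.
have [t1|t1] := ltP 1 `|t|.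
  by rewrite us// normr0 mulr_ge0 ?powR_ge0// divr_ge0// ltW.
apply: (@le_trans _ _ `|u c|).
  by apply: ucmax; rewrite in_itv/= -ler_norml.
rewrite -mulrA ler_peMr// mulrC ler_pdivlMr// mul1r.
by apply: ge0_ler_powR => //; rewrite ?nnegrE ltW.
Unshelve. all: by end_near. Qed.

Lemma Rintegral_rescale G h : 0 < h -> continuous G ->
  \int[mu]_(t in `[- h^-1, h^-1]) (h * G (h * t)) =
  \int[mu]_(s in `[-1, 1]) G s.
Proof.
move=> h0 Gc.
have hV : h * h^-1 = 1 by rewrite divff// gt_eqF.
have dF : derive1 (fun t : R => (h * t : R^o)) = cst h.
  apply/funext => x; rewrite derive1E.
  by rewrite deriveM// derive_cst derive_id; rewrite /GRing.scale/= mulr1 mulr0 addr0.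
have := @integration_by_substitution_increasing R (fun t => h * t) G (- h^-1) h^-1.
rewrite mulrN hV => H; rewrite /Rintegral; congr fine; rewrite H.
- apply: eq_integral => x _; rewrite /= dF; congr (_%:E).
  by rewrite /GRing.mul/= mulrC.
- by have : 0 < h^-1 by [rewrite invr_gt0|]; lra.
- by move=> x y _ _ xy; rewrite ltr_pM2l.
- by move=> x _; rewrite dF; exact: cvg_cst.
- by rewrite dF; exact: is_cvg_cst.
- by rewrite dF; exact: is_cvg_cst.
- split.
  + by move=> x _; apply: derivableM.
  + by apply: cvg_at_right_filter; apply: cvgM; [exact: cvg_cst|exact: cvg_id].
  + by apply: cvg_at_left_filter; apply: cvgM; [exact: cvg_cst|exact: cvg_id].
- by apply: continuous_subspaceT.
Qed.

Lemma Rintegral_kernel_scale u h : 0 < h -> continuous u ->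
  \int[mu]_(t in `[- h^-1, h^-1]) kernel_scale u h t =
  \int[mu]_(s in `[-1, 1]) u s.
Proof. by move=> h0 uc; rewrite -(Rintegral_rescale h0 uc). Qed.

Lemma Rintegral_sqr_kernel_scale u h : 0 < h -> continuous u ->
  h ^+ 2 * \int[mu]_(t in `[- h^-1, h^-1]) (t ^+ 2 * kernel_scale u h t) =
  \int[mu]_(s in `[-1, 1]) (s ^+ 2 * u s).
Proof.
move=> h0 uc; rewrite -(@Rintegral_rescale (fun s => s ^+ 2 * u s) _ h0); last first.
  by move=> x; apply: cvgM; [exact: exprn_continuous|exact: uc].
rewrite -RintegralZl//.
  by apply: eq_Rintegral => t _; rewrite /kernel_scale; ring.
apply: continuous_compact_integrable; first exact: segment_compact.
apply: continuous_subspaceT => x.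
apply: cvgM; first exact: exprn_continuous.
apply: cvgM; first exact: cvg_cst.
apply: continuous_comp; last exact: uc.
by apply: cvgM; [exact: cvg_cst|exact: cvg_id].
Qed.

End kernel.

(** * The bias integral *)

Section bias.
Context {R : realType}.
Local Notation mu := (@lebesgue_measure R).

(** Origin of [h^(1 + beta)]: one factor from the prefactor of the kernel, [beta] factors from the
    vanishing of [u] at 0. *)
Lemma kernel_scale_bound (u : R -> R) beta C h t : 0 < h ->
  (forall s, `|u s| <= C * `|s| `^ beta) ->
  `|kernel_scale u h t| <= C * h `^ (1 + beta) * `|t| `^ beta.
Proof.
move=> h0 uC; rewrite /kernel_scale normrM (gtr0_norm h0).
apply: (@le_trans _ _ (h * (C * `|h * t| `^ beta))).
  by rewrite ler_pM2l.
rewrite normrM (gtr0_norm h0) powRM//; last exact: ltW.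
have -> : h `^ (1 + beta) = h * h `^ beta.
  by rewrite powRD ?powRr1 ?(ltW h0)// (gt_eqF h0) implybT.
by rewrite le_eqVlt; apply/orP; left; apply/eqP; ring.
Qed.

Lemma bias_bound (u f : R -> R) beta C h L : 0 < h -> 0 < C -> continuous u ->
  (forall s, `|u s| <= C * `|s| `^ beta) ->
  (forall s, `|u s| <= C) ->
  prob_density f ->
  (\int[mu]_t (`|t| `^ beta * cmod (phi_density f t))%:E <= L%:E)%E ->
  `|\int[mu]_(t in `[- h^-1, h^-1])
     (complex.Re (phi_density f t) * kernel_scale u h t)| <=
  C * h `^ (1 + beta) * L.
Proof.
move=> h0 C0 uc uC uC' fd fL.
set psi := fun t => complex.Re (phi_density f t).
have mpsi : measurable_fun [set: R] psi by exact: measurable_Re_phi_density.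
have psi1 t : `|psi t| <= 1 by exact: normr_Re_phi_density_le1.
have mk : measurable_fun [set: R] (kernel_scale u h).
  apply: continuous_measurable_fun => x.
  apply: cvgM; first exact: cvg_cst.
  apply: continuous_comp; last exact: uc.
  by apply: cvgM; [exact: cvg_cst|exact: cvg_id].
set I := `[- h^-1, h^-1].
have muI : (mu [set` I] < +oo)%E.
  by rewrite lebesgue_measure_itv/=; case: ifP => _; rewrite ltry.
have intk : mu.-integrable [set` I] (EFin \o (fun t => psi t * kernel_scale u h t)).
  apply: (@bounded_integrable _ _ _ _ _ _ (h * C)) => //.
  - by apply: measurable_funTS; exact: measurable_funM.
  - move=> x _; rewrite normrM /kernel_scale normrM (gtr0_norm h0) -[leRHS]mul1r.
    by rewrite ler_pM ?mulr_ge0 ?(ltW h0)// ler_pM2l.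
rewrite -lee_fin.
apply: (@le_trans _ _ (\int[mu]_(t in [set` I])
    (`|psi t * kernel_scale u h t|)%:E)%E).
  apply: le_trans (_ : _ <= (\int[mu]_(t in [set` I])
     `|psi t * kernel_scale u h t|)%:E)%E _.
    by rewrite lee_fin; exact: le_normr_Rintegral.
  rewrite /Rintegral fineK//.
  apply: integrable_fin_num => //; exact: (integrable_norm intk).
rewrite integral_mkcond.
(* The constant is pulled out while the integrand is still [|psi|], whose measurability is
   established; passing to [cmod] comes last, by a comparison that asks for none. *)
apply: (@le_trans _ _ (\int[mu]_t
    ((C * h `^ (1 + beta))%:E * (`|t| `^ beta * `|psi t|)%:E))%E).
  apply: ge0_le_integral_setT => x; rewrite /patch; case: ifPn => //= _.
    rewrite lee_fin normrM mulrC.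
    by rewrite mulrA ler_wpM2r// kernel_scale_bound.
  by rewrite -EFinM lee_fin !mulr_ge0// ?powR_ge0// ltW.
rewrite ge0_integralZl_EFin//; last 2 first.
- apply/measurable_EFinP; apply: measurable_funM.
  + by apply: (@measurableT_comp _ _ _ _ _ _ (fun x => x `^ beta)) => //.
  + exact: measurableT_comp.
- by rewrite mulr_ge0 ?powR_ge0// ltW.
rewrite [leRHS]EFinM; apply: lee_wpmul2l.
  by rewrite lee_fin mulr_ge0 ?powR_ge0// ltW.
apply: le_trans fL; apply: ge0_le_integral_setT => x; rewrite lee_fin.
  by rewrite mulr_ge0 ?powR_ge0.
by rewrite ler_wpM2l ?powR_ge0// normr_Re_le_cmod.
Qed.

End bias.

(** * Powers of [ln n] and of the bandwidth *)

Section asymptotics.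
Context {R : realType}.

(* [1 + y <= expR y] at [y = d x / p], raised to the power [p]. *)
Lemma powR_le_expR (p d x : R) : 0 < p -> 0 < d -> 0 <= x ->
  x `^ p <= (p / d) `^ p * expR (d * x).
Proof.
move=> p0 d0 x0.
have -> : x = (p / d) * (d * x / p) by field; rewrite !gt_eqF.
rewrite powRM ?divr_ge0 ?mulr_ge0 ?(ltW p0) ?(ltW d0)//.
apply: ler_wpM2l; first exact: powR_ge0.
have -> : d * (p / d * (d * x / p)) = d * x / p * p by field; rewrite !gt_eqF.
have y0 : 0 <= d * x / p by rewrite divr_ge0 ?mulr_ge0// ltW.
set y := d * x / p in y0 *.
apply: (@le_trans _ _ (expR y `^ p)).
  apply: ge0_ler_powR; rewrite ?nnegrE ?expR_ge0 ?(ltW p0)//.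
  by have := expR_ge1Dx y; lra.
by rewrite /powR gt_eqF ?expR_gt0// expRK mulrC.
Qed.

Lemma near_ln_ge (a : R) : \forall n \near \oo, a <= ln (n%:R : R).
Proof.
near=> n.
rewrite -[a]expRK ler_ln ?posrE ?expR_gt0//; last first.
  by rewrite ltr0n; near: n; exact: nbhs_infty_gt.
by near: n; exact: nbhs_infty_ger.
Unshelve. all: by end_near. Qed.

Lemma bandwidth_gt0 (eta : R) n : 0 < eta * ln n%:R -> 0 < bandwidth eta n.
Proof. by move=> e0; rewrite powR_gt0. Qed.

Lemma bandwidth_exprN2 (eta : R) n : 0 < eta * ln n%:R ->
  bandwidth eta n ^- 2 = eta * ln n%:R.
Proof.
move=> e0; rewrite /bandwidth -exprVn -powRN opprK -powR_mulrn ?powR_ge0//.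
by rewrite -powRrM mulVf ?powRr1// ltW.
Qed.

Lemma powR_bandwidth (eta p : R) n : 0 < eta -> 0 < ln (n%:R : R) ->
  bandwidth eta n `^ p = eta `^ (- (p / 2)) * ln n%:R `^ (- (p / 2)).
Proof.
move=> e0 l0; rewrite /bandwidth -powRrM -powRM ?ltW//.
by congr (_ `^ _); field.
Qed.

End asymptotics.

(* If [r >= b / 2] the logarithm is [2 / b]-Lipschitz near [b]; otherwise
   [`|r - b| / b >= 1 / 2] and the truncation alone gives the bound. *)
Lemma trunc_log_error {R : realType} (M r b : R) : 1 <= M ->
  expR (- M) <= b <= expR M ->
  `|trunc_log M r - ln b| <= 4 * M / b * `|r - b|.
Proof.
move=> M1 /andP[Mb bM].
have M0 : 0 <= M by lra.
have b0 : 0 < b by rewrite (lt_le_trans _ Mb) ?expR_gt0.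
have nrb0 := normr_ge0 (r - b).
have nrb1 := ler_norm (r - b).
have nrb2 : b - r <= `|r - b| by rewrite distrC ler_norm.
have [rb|rb] := leP (b / 2) r.
  rewrite trunc_logE//.
  have cb : b / 2 <= clamp M r.
    by rewrite /clamp le_max le_min rb andbT; apply/orP; right; lra.
  (* Clamping projects onto an interval that contains [b], so it cannot move [r] away from [b]. *)
  have dist : `|clamp M r - b| <= `|r - b|.
    rewrite ler_norml /clamp.
    have [Mr|Mr] := leP (expR M) r.
      by rewrite max_r; [apply/andP; split; lra|lra].
    by have [Mr'|Mr'] := leP (expR (- M)) r; apply/andP; split; lra.
  have b20 : 0 < b / 2 by lra.
  apply: le_trans (ln_lipschitz b20 cb _) _; first by lra.
  have -> : `|clamp M r - b| / (b / 2) = 2 / b * `|clamp M r - b|.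
    by field; rewrite gt_eqF.
  apply: ler_pM => //; first by rewrite divr_ge0// ltW.
  by rewrite ler_pM2r ?invr_gt0//; lra.
have lnb : `|ln b| <= M.
  rewrite ler_norml; apply/andP; split.
    by rewrite -[leLHS]expRK ler_ln ?posrE ?expR_gt0.
  by rewrite -[leRHS]expRK ler_ln ?posrE ?expR_gt0.
apply: (@le_trans _ _ (M + M)).
  by rewrite (le_trans (ler_normB _ _))// lerD// trunc_log_bound.
have -> : M + M = 4 * M / b * (b / 2) by field; rewrite gt_eqF.
apply: ler_wpM2l; first by rewrite divr_ge0 ?mulr_ge0// ltW.
lra.
Qed.

(** * Mean square deviation of [phi_emp] over the frequency window *)

Section empirical_deviation.
Context {R : realType} d {T : measurableType d} (P : probability T R).
Context (X : {RV P >-> R}) (n : nat) (Xs : 'I_n -> {RV P >-> R}).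
Local Notation mu := (@lebesgue_measure R).

(** This is [|phi_emp t - phi_X t|^2] on the sample path [w], in coordinates. *)
Definition sqr_deviation (w : T) (t : R) : R :=
  (n%:R^-1 * \sum_(j < n) cos (t * Xs j w) - complex.Re (char_fun X t)) ^+ 2 +
  (n%:R^-1 * \sum_(j < n) sin (t * Xs j w) - complex.Im (char_fun X t)) ^+ 2.

Lemma sqr_deviation_ge0 w t : 0 <= sqr_deviation w t.
Proof. by rewrite addr_ge0// sqr_ge0. Qed.


Lemma measurable_Rintegral_compM (g : R -> R) : continuous g ->
  (forall x, `|g x| <= 1) ->
  measurable_fun [set: R] (fun t => \int[P]_w g (t * X w)).
Proof.
move=> gc g1; apply: continuous_measurable_fun => t.
have mg : measurable_fun [set: R] g by exact: continuous_measurable_fun.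
apply: (@continuity_under_integral R _ _ P (fun t w => g (t * X w))
  setT measurableT (t - 1) (t + 1) _ _ (cst 1)).
- move=> s _; apply: (@bounded_integrable_probability _ _ _ _ _ 1) => //.
  by apply: (measurableT_comp mg); exact: measurable_funM.
- apply: aeW => y _ s _; apply: continuous_comp; last exact: gc.
  by apply: cvgM; [exact: cvg_id|exact: cvg_cst].
- by apply: (@bounded_integrable_probability _ _ _ _ _ 1) => // w; rewrite normr1.
- by move=> s _; apply: aeW => y _; exact: g1.
- by rewrite inE/= in_itv/=; apply/andP; split; lra.
Qed.

(** Joint measurability in [(w, t)] is what Tonelli requires. *)
Lemma measurable_sqr_deviation :
  measurable_fun [set: T * measurableTypeR R] (fun z => sqr_deviation z.1 z.2).
Proof.
have mXs j : measurable_fun [set: T * measurableTypeR R] (fun z => z.2 * Xs j z.1).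
  apply: measurable_funM; first exact: measurable_snd.
  by apply: (measurableT_comp _ measurable_fst).
have mcos : measurable_fun [set: R] (@cos R).
  by apply: continuous_measurable_fun; exact: continuous_cos.
have msin : measurable_fun [set: R] (@sin R).
  by apply: continuous_measurable_fun; exact: continuous_sin.
have mRe : measurable_fun [set: measurableTypeR R]
    (fun t => complex.Re (char_fun X t)).
  rewrite (_ : (fun t => _) = fun t => \int[P]_w cos (t * X w)); last first.
    by apply/funext => s; rewrite Re_char_fun.
  apply: measurable_Rintegral_compM; first exact: continuous_cos.
  by move=> x; rewrite ler_norml cos_geN1 cos_le1.
have mIm : measurable_fun [set: measurableTypeR R]
    (fun t => complex.Im (char_fun X t)).
  rewrite (_ : (fun t => _) = fun t => \int[P]_w sin (t * X w)); last first.
    by apply/funext => s; rewrite Im_char_fun.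
  apply: measurable_Rintegral_compM; first exact: continuous_sin.
  by move=> x; rewrite ler_norml sin_geN1 sin_le1.
apply: measurable_funD; apply: measurable_funX; apply: measurable_funB.
- apply: measurable_funM => //; apply: measurable_sum => j.
  exact: (measurableT_comp mcos (mXs j)).
- exact: (measurableT_comp mRe measurable_snd).
- apply: measurable_funM => //; apply: measurable_sum => j.
  exact: (measurableT_comp msin (mXs j)).
- exact: (measurableT_comp mIm measurable_snd).
Qed.

(** The cosine and sine parts contribute [1 / n] each. *)
Lemma integral_sqr_deviation t : (0 < n)%N -> iid_copies X Xs ->
  (\int[P]_w (sqr_deviation w t)%:E <= (2 / n%:R)%:E)%E.
Proof.
move=> n0 iid.
have mM : measurable_fun [set: R] (fun x => t * x) by exact: measurable_funM.
have key (g : R -> R) : continuous g -> (forall x, `|g x| <= 1) ->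
    let F w := (n%:R^-1 * (\sum_(j < n) g (t * Xs j w)) -
      \int[P]_w g (t * X w)) ^+ 2 in
    measurable_fun [set: T] F /\ (\int[P]_w (F w)%:E <= n%:R^-1%:E)%E.
  move=> gc g1 F.
  have mg : measurable_fun [set: R] (fun x => g (t * x)).
    by apply: measurableT_comp mM; exact: continuous_measurable_fun.
  have mF : measurable_fun [set: T] F.
    apply: measurable_funX; apply: measurable_funB => //.
    apply: measurable_funM => //; apply: measurable_sum => j.
    exact: (measurableT_comp mg).
  split => //.
  have sum1 w : `|n%:R^-1 * (\sum_(j < n) g (t * Xs j w))| <= 1.
    rewrite normrM ger0_norm// mulrC ler_pdivrMr ?ltr0n// mul1r.
    apply: le_trans (ler_norm_sum _ _ _) _.
    rewrite (_ : n%:R = \sum_(j < n) 1) ?ler_sum//.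
    by rewrite sumr_const card_ord.
  have iF : P.-integrable [set: T] (EFin \o F).
    set a := \int[P]_w g (t * X w).
    apply: (@bounded_integrable_probability _ _ _ _ _ ((1 + `|a|) ^+ 2)) => // w.
    rewrite normrX ler_pXn2r ?nnegrE ?addr_ge0//.
    by rewrite (le_trans (ler_normB _ _))// lerD.
  have -> : (\int[P]_w (F w)%:E)%E = (\int[P]_w F w)%:E.
    by rewrite /Rintegral fineK// integrable_fin_num.
  rewrite lee_fin.
  by apply: (@empirical_mean_variance _ _ _ _ _ _ _ (fun x => g (t * x)) n0 iid mg).
have [mc cn] := key cos (@continuous_cos R)
  (fun x => ltac:(by rewrite ler_norml cos_geN1 cos_le1)).
have [ms sn] := key sin (@continuous_sin R)
  (fun x => ltac:(by rewrite ler_norml sin_geN1 sin_le1)).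
rewrite /sqr_deviation Re_char_fun Im_char_fun.
under eq_integral do rewrite EFinD.
rewrite ge0_integralD//; first last.
- exact/measurable_EFinP.
- by move=> w _; rewrite lee_fin sqr_ge0.
- exact/measurable_EFinP.
- by move=> w _; rewrite lee_fin sqr_ge0.
have -> : 2 / n%:R = n%:R^-1 + n%:R^-1 :> R by rewrite -mulr2n mulr_natl.
by rewrite EFinD leeD.
Qed.

(** The window becomes an indicator so that Tonelli can be applied on the full product space. *)
Lemma integrated_sqr_deviationE (I : set R) w :
  (\int[mu]_(t in I) (sqr_deviation w t)%:E =
   \int[mu]_t (sqr_deviation w t * \1_I t)%:E)%E.
Proof.
rewrite integral_mkcond; apply: eq_integral => t _.
rewrite /patch indicE; case: ifPn => _; first by rewrite mulr1.
by rewrite mulr0.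
Qed.

Let measurable_sqr_deviation_indic (I : set R) : measurable I ->
  measurable_fun [set: T * measurableTypeR R]
    (fun z => (sqr_deviation z.1 z.2 * \1_I z.2)%:E).
Proof.
move=> mI; apply/measurable_EFinP; apply: measurable_funM.
  exact: measurable_sqr_deviation.
apply: (@measurableT_comp _ _ _ _ _ _ (\1_I : R -> R) _ snd).
  exact: measurable_indic.
exact: measurable_snd.
Qed.

Lemma measurable_integrated_sqr_deviation (I : set R) : measurable I ->
  measurable_fun [set: T]
    (fun w => \int[mu]_(t in I) (sqr_deviation w t)%:E)%E.
Proof.
move=> mI; under eq_fun do rewrite integrated_sqr_deviationE.
have := @measurable_fun_fubini_tonelli_F _ _ _ _ _ mu _
  (measurable_sqr_deviation_indic mI).
by apply => z; rewrite lee_fin mulr_ge0// sqr_deviation_ge0.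
Qed.

(** After exchanging the integrals, the bound [2 / n] at each frequency is multiplied by the window
    length [2 / h]. *)
Lemma integral_integrated_sqr_deviation (h : R) :
  0 < h -> (0 < n)%N -> iid_copies X Xs ->
  (\int[P]_w \int[mu]_(t in `[(- h^-1)%R, h^-1%R]) (sqr_deviation w t)%:E <=
   (4 / (n%:R * h))%:E)%E.
Proof.
move=> h0 n0 iid.
pose I : set R := `[- h^-1, h^-1]%classic.
have mI : measurable I by exact: measurable_itv.
have muI : mu I = (2 / h)%:E.
  have hV : 0 < h^-1 by rewrite invr_gt0.
  rewrite /I lebesgue_measure_itv/= lte_fin ifT; last by lra.
  by rewrite -EFinB; congr (_%:E); field; rewrite gt_eqF.
under eq_integral do rewrite -/I integrated_sqr_deviationE.
rewrite (@fubini_tonelli _ _ _ _ _ P mu _ (measurable_sqr_deviation_indic mI)); last first.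
  by move=> z; rewrite lee_fin mulr_ge0// sqr_deviation_ge0.
apply: (@le_trans _ _ (\int[mu]_(t in I) (2 / n%:R)%:E)%E).
  rewrite [leRHS]integral_mkcond; apply: ge0_le_integral_setT => t /=.
    by apply: integral_ge0 => w _; rewrite lee_fin mulr_ge0// sqr_deviation_ge0.
  rewrite /patch indicE; case: ifPn => _.
    by under eq_integral do rewrite mulr1; exact: integral_sqr_deviation.
  by under eq_integral do rewrite mulr0; rewrite integral0.
have -> : (\int[mu]_(t in I) (2 / n%:R)%:E = (2 / n%:R)%:E * (2 / h)%:E)%E.
  by rewrite -muI; exact: integral_cst.
rewrite -EFinM lee_fin le_eqVlt.
apply/orP; left; apply/eqP; field.
by rewrite pnatr_eq0 -lt0n n0 gt_eqF.
Qed.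

End empirical_deviation.

Lemma sqrD_le {R : realDomainType} (x y p q : R) : x ^+ 2 <= p -> y ^+ 2 <= q ->
  (x + y) ^+ 2 <= 2 * p + 2 * q.
Proof. by have := sqr_ge0 (x - y); nra. Qed.

(** * Non-asymptotic risk bound for a fixed law, with [h], [M] and a modulus floor [kappa] as free
    parameters *)

Section risk_bound.
Context {R : realType}.
Local Notation mu := (@lebesgue_measure R).
Variables (u : R -> R) (beta C : R).
Hypotheses (u_cont : continuous u) (C_gt0 : 0 < C).
Hypotheses (u_beta : forall s, `|u s| <= C * `|s| `^ beta).
Hypotheses (u_bound : forall s, `|u s| <= C).
Hypothesis u_int : \int[mu]_(t in `[-1, 1]) u t = -1.
Hypothesis u_int2 : \int[mu]_(t in `[-1, 1]) (t ^+ 2 * u t) = 0.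
Variables (gamma sigma L Lambda lambda : R) (rho f : R -> R).
Hypotheses (rhoE : forall x, rho x = lambda * f x) (fd : prob_density f).
Hypothesis fL : (\int[mu]_t (`|t| `^ beta * cmod (phi_density f t))%:E <= L%:E)%E.
Hypothesis lambda_bounds : 0 < lambda <= Lambda.
Variables (h M kappa : R).
Hypotheses (h_gt0 : 0 < h) (M_ge1 : 1 <= M) (kappa_gt0 : 0 < kappa).
Hypothesis kappa_le : forall t, `|t| <= h^-1 ->
  kappa <= cmod (phi_levy gamma sigma rho t).
Hypothesis M_kappa : expR (- M) <= kappa.

Let phi t := cmod (phi_levy gamma sigma rho t).
Let psi t := complex.Re (phi_density f t).
Let k := kernel_scale u h.
Let I : set R := `[- h^-1, h^-1]%classic.

Let mI : measurable (I : set (measurableTypeR R)). Proof. exact: measurable_itv. Qed.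

Let muI : mu I = (2 / h)%:E.
Proof.
have hV : 0 < h^-1 by rewrite invr_gt0.
rewrite /I lebesgue_measure_itv/= lte_fin ifT; last by lra.
by rewrite -EFinB; congr (_%:E); field; rewrite gt_eqF.
Qed.

Let muI_lty : (mu I < +oo)%E. Proof. by rewrite muI ltry. Qed.

Let in_I t : I t -> `|t| <= h^-1.
Proof. by rewrite /I/= in_itv/= -ler_norml. Qed.

(** The lower bound goes through [kappa]; the upper one holds because the exponent of [phi] is
    nonpositive, as [Re phi_f <= 1]. *)
Let phi_bounds t : I t -> expR (- M) <= phi t <= expR M.
Proof.
move=> It; rewrite (le_trans M_kappa (kappa_le (in_I It)))/=.
rewrite /phi (cmod_phi_levy _ _ _ rhoE fd) ler_expR.
have /ler_normlP[_ p1] := normr_Re_phi_density_le1 t fd.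
have /andP[l0 _] := lambda_bounds.
have q : 0 <= 2^-1 * sigma ^+ 2 * t ^+ 2 by rewrite mulr_ge0 ?sqr_ge0// mulr_ge0 ?sqr_ge0//.
have : lambda * complex.Re (phi_density f t) <= lambda.
  by rewrite -[leRHS]mulr1 ler_pM2l.
have := M_ge1; lra.
Qed.

Let mk : measurable_fun [set: R] k.
Proof.
apply: continuous_measurable_fun => x.
apply: cvgM; first exact: cvg_cst.
apply: continuous_comp; last exact: u_cont.
by apply: cvgM; [exact: cvg_cst|exact: cvg_id].
Qed.

Let k_bound t : `|k t| <= h * C.
Proof. by rewrite normrM (gtr0_norm h_gt0) ler_pM2l. Qed.

Let mpsi : measurable_fun [set: R] psi.
Proof. exact: measurable_Re_phi_density. Qed.

Let integrableI (g : R -> R) b : measurable_fun [set: R] g ->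
  (forall t, I t -> `|g t| <= b) -> mu.-integrable I (EFin \o g).
Proof.
move=> mg gb; apply: (@bounded_integrable _ _ _ _ _ _ b) => //.
exact: measurable_funTS.
Qed.

Let lnphiE t : ln (phi t) =
  - lambda - 2^-1 * sigma ^+ 2 * t ^+ 2 + lambda * psi t.
Proof. by rewrite /phi (cmod_phi_levy _ _ _ rhoE fd) expRK. Qed.

Let mlnphi : measurable_fun [set: R] (fun t => ln (phi t)).
Proof.
under eq_fun do rewrite lnphiE.
apply: measurable_funD; last exact: measurable_funM.
apply: measurable_funB => //; apply: measurable_funM => //.
Qed.

Let lnphi_bound t : I t -> `|ln (phi t)| <= M.
Proof.
move=> It; have /andP[a b] := phi_bounds It.
have p0 : 0 < phi t by rewrite (lt_le_trans _ a) ?expR_gt0.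
rewrite ler_norml; apply/andP; split.
  by rewrite -[leLHS]expRK ler_ln ?posrE ?expR_gt0.
by rewrite -[leRHS]expRK ler_ln ?posrE ?expR_gt0.
Qed.

Let bias := \int[mu]_(t in I) (psi t * k t).

(** Total mass [-1] turns [- lambda] into [lambda], and the zero second moment removes the Gaussian
    term, which would otherwise grow like [h^-2]. *)
Lemma Rintegral_ln_phi :
  \int[mu]_(t in I) (ln (phi t) * k t) = lambda + lambda * bias.
Proof.
have hV : 0 < h^-1 by rewrite invr_gt0.
have ik : mu.-integrable I (EFin \o k) by apply: (@integrableI _ (h * C)).
have it2k : mu.-integrable I (EFin \o (fun t => t ^+ 2 * k t)).
  apply: (@integrableI _ (h^-1 ^+ 2 * (h * C))).
    exact: measurable_funM.
  move=> t /in_I th; rewrite normrM ler_pM// normrX ler_pXn2r ?nnegrE//.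
  exact: ltW.
have ipk : mu.-integrable I (EFin \o (fun t => psi t * k t)).
  apply: (@integrableI _ (1 * (h * C))); first exact: measurable_funM.
  by move=> t _; rewrite normrM ler_pM// normr_Re_phi_density_le1.
have iZ (a : R) (g : R -> R) : mu.-integrable I (EFin \o g) ->
    mu.-integrable I (EFin \o (fun x => a * g x)).
  by move=> ?; apply: (@integrableZl _ _ _ mu _ _ _ (EFin \o g)).
have iD (g1 g2 : R -> R) : mu.-integrable I (EFin \o g1) ->
    mu.-integrable I (EFin \o g2) ->
    mu.-integrable I (EFin \o (fun x => g1 x + g2 x)).
  by move=> ? ?; apply: (@integrableD _ _ _ mu _ _ (EFin \o g1) (EFin \o g2)).
set a := - (2^-1 * sigma ^+ 2).
transitivity (\int[mu]_(t in I)
    ((- lambda * k t + a * (t ^+ 2 * k t)) + lambda * (psi t * k t))).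
  by apply: eq_Rintegral => t _; rewrite lnphiE /a; ring.
rewrite (RintegralD mI (iD _ _ (iZ _ _ ik) (iZ _ _ it2k)) (iZ _ _ ipk)).
rewrite (RintegralD mI (iZ _ _ ik) (iZ _ _ it2k)).
rewrite (RintegralZl _ mI ik) (RintegralZl _ mI it2k) (RintegralZl _ mI ipk).
have -> : \int[mu]_(t in I) (t ^+ 2 * k t) = 0.
  have := Rintegral_sqr_kernel_scale h_gt0 u_cont.
  rewrite u_int2 => /eqP; rewrite mulf_eq0 sqrf_eq0 gt_eqF//= => /eqP.
  exact.
have -> : \int[mu]_(t in I) k t = -1.
  by rewrite -u_int -(Rintegral_kernel_scale h_gt0 u_cont).
by rewrite mulr0 addr0 mulrN1 opprK.
Qed.

Context d {T : measurableType d} (P : probability T R).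
Context (X : {RV P >-> R}) (n : nat) (Xs : 'I_n -> {RV P >-> R}).
Hypothesis charX : forall t, char_fun X t = phi_levy gamma sigma rho t.
Hypotheses (iidX : iid_copies X Xs) (n_gt0 : (0 < n)%N).

Let est w := \int[mu]_(t in I)
  (trunc_log M (cmod (phi_emp (fun j => Xs j w) t)) * k t).

(** A pathwise inequality: the error is the integral of [g] plus [lambda * bias]. In [4 / h], a
    factor 2 comes from [(x + y)^2 <= 2 x^2 + 2 y^2] and [2 / h] is the window length in
    Cauchy-Schwarz; [h * C] bounds the kernel and [4 * M / kappa] is the Lipschitz constant of the
    truncated logarithm. *)
Lemma sqr_error_le w : (((est w - intensity rho) ^+ 2)%:E <=
  (4 / h * (h * C * (4 * M / kappa)) ^+ 2)%:E *
    \int[mu]_(t in I) (sqr_deviation X Xs w t)%:E +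
  (2 * (Lambda * (C * h `^ (1 + beta) * L)) ^+ 2)%:E)%E.
Proof.
have M0 : 0 <= M by have := M_ge1; lra.
set c := h * C * (4 * M / kappa).
set B := C * h `^ (1 + beta) * L.
have biasB : `|bias| <= B by exact: bias_bound.
set tr := fun t => trunc_log M (cmod (phi_emp (fun j => Xs j w) t)).
have mtr : measurable_fun [set: R] tr.
  apply: measurableT_comp; first exact: measurable_trunc_log.
  exact: measurable_cmod_phi_emp.
have trM t : `|tr t| <= M by exact: trunc_log_bound.
pose g t := tr t * k t - ln (phi t) * k t.
have mg : measurable_fun [set: R] g.
  by apply: measurable_funB; exact: measurable_funM.
have ge1 t : I t -> g t ^+ 2 <= c ^+ 2 * sqr_deviation X Xs w t.
  move=> It; rewrite /g -mulrBl exprMn.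
  have := trunc_log_error (cmod (phi_emp (fun j => Xs j w) t)) M_ge1 (phi_bounds It).
  rewrite -/(tr t); set D := `|_ - phi t| => trerr.
  have D0 : 0 <= D by exact: normr_ge0.
  have D2 : D ^+ 2 <= sqr_deviation X Xs w t.
    rewrite /D real_normK ?num_real//.
    apply: le_trans (sqr_cmodB_le _ _) _.
    by rewrite /sqr_deviation charX phi_empE.
  have pt := kappa_le (in_I It).
  have trerr2 : `|tr t - ln (phi t)| <= 4 * M / kappa * D.
    apply: le_trans trerr _; apply: ler_wpM2r => //.
    rewrite ler_wpM2l ?mulr_ge0// lef_pV2 ?posrE//.
    exact: lt_le_trans kappa_gt0 pt.
  have e1 : (tr t - ln (phi t)) ^+ 2 <= (4 * M / kappa) ^+ 2 * D ^+ 2.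
    rewrite -[leLHS]real_normK ?num_real// -exprMn ler_pXn2r ?nnegrE//.
    by rewrite mulr_ge0// divr_ge0 ?mulr_ge0// ltW.
  have e2 : k t ^+ 2 <= (h * C) ^+ 2.
    rewrite -[leLHS]real_normK ?num_real// ler_pXn2r ?nnegrE//.
    by rewrite mulr_ge0 ?ltW.
  apply: (@le_trans _ _ ((4 * M / kappa) ^+ 2 * D ^+ 2 * (h * C) ^+ 2)).
    by apply: ler_pM => //; exact: sqr_ge0.
  have -> : (4 * M / kappa) ^+ 2 * D ^+ 2 * (h * C) ^+ 2 = c ^+ 2 * D ^+ 2.
    by rewrite /c; ring.
  by rewrite ler_wpM2l ?sqr_ge0.
have itr : mu.-integrable I (EFin \o (fun t => tr t * k t)).
  apply: (@integrableI _ (M * (h * C))); first exact: measurable_funM.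
  by move=> t _; rewrite normrM ler_pM.
have iln : mu.-integrable I (EFin \o (fun t => ln (phi t) * k t)).
  apply: (@integrableI _ (M * (h * C))); first exact: measurable_funM.
  by move=> t It; rewrite normrM ler_pM// lnphi_bound.
have errE : est w - intensity rho = \int[mu]_(t in I) g t + lambda * bias.
  rewrite (RintegralB mI itr iln) Rintegral_ln_phi (intensityE rhoE fd).
  by rewrite -/(est w); ring.
have gb t : I t -> `|g t| <= M * (h * C) + M * (h * C).
  move=> It; rewrite (le_trans (ler_normB _ _))//.
  by rewrite lerD// normrM ler_pM// lnphi_bound.
have cs : (\int[mu]_(t in I) g t) ^+ 2 <= 2 / h * \int[mu]_(t in I) g t ^+ 2.
  rewrite (_ : 2 / h = fine (mu I)); last by rewrite muI.
  by apply: sqr_Rintegral_le mI muI_lty (measurable_funTS mg) gb.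
have ig2 : mu.-integrable I (EFin \o (fun t => g t ^+ 2)).
  apply: (@integrableI _ ((M * (h * C) + M * (h * C)) ^+ 2)).
    exact: measurable_funX.
  move=> t It; rewrite normrX ler_pXn2r ?nnegrE ?gb//.
  exact: le_trans (gb _ It).
apply: (@le_trans _ _ ((4 / h * \int[mu]_(t in I) g t ^+ 2 +
    2 * (Lambda * B) ^+ 2)%:E)).
  rewrite lee_fin errE.
  have lb : (lambda * bias) ^+ 2 <= (Lambda * B) ^+ 2.
    have /andP[l0 lL] := lambda_bounds.
    have B0 : 0 <= B by exact: le_trans biasB.
    have LB0 : 0 <= Lambda * B by rewrite mulr_ge0// (le_trans (ltW l0)).
    rewrite -[leLHS]real_normK ?num_real// ler_pXn2r ?nnegrE//.
    by rewrite normrM (gtr0_norm l0) ler_pM// ltW.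
  have -> : 4 / h = 2 * (2 / h) by field; rewrite gt_eqF.
  by rewrite -mulrA; exact: sqrD_le.
rewrite EFinD leeD2r//.
have -> : ((4 / h * \int[mu]_(t in I) g t ^+ 2)%:E =
    (4 / h)%:E * \int[mu]_(t in I) (g t ^+ 2)%:E)%E.
  by rewrite EFinM; congr (_ * _)%E; rewrite /Rintegral fineK// integrable_fin_num.
have h4 : 0 <= 4 / h by rewrite divr_ge0// ltW.
rewrite [X in (_ <= X * _)%E]EFinM -muleA; apply: lee_wpmul2l.
  by rewrite lee_fin.
have mdev : measurable_fun [set: R] (sqr_deviation X Xs w).
  have := measurableT_comp (measurable_sqr_deviation X Xs) (@pair1_measurable _ _ T R w).
  exact.
rewrite -ge0_integralZl_EFin ?sqr_ge0//; last 2 first.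
- by move=> t _; rewrite lee_fin sqr_deviation_ge0.
- by apply/measurable_EFinP; exact: measurable_funTS.
by apply: ge0_le_integral_set => t It; rewrite -?EFinM lee_fin ?sqr_ge0// ge1.
Qed.

(** Only the majorant of [sqr_error_le] is shown to be measurable in [w]; monotonicity of the
    integral of nonnegative functions transfers its mean to the squared error. *)
Lemma risk_le :
  ('E_P[fun w => ((est w - intensity rho) ^+ 2)%R] <=
  (256 * C ^+ 2 * M ^+ 2 / (kappa ^+ 2 * n%:R) +
   2 * (Lambda * (C * h `^ (1 + beta) * L)) ^+ 2)%:E)%E.
Proof.
rewrite unlock.
apply: (le_trans (ge0_le_integral_setT _ (fun w => _) sqr_error_le)).
  by move=> w; rewrite lee_fin sqr_ge0.
set c1 := 4 / h * _; set c2 := 2 * _.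
have c10 : 0 <= c1 by rewrite mulr_ge0 ?sqr_ge0// divr_ge0// ltW.
have c20 : 0 <= c2 by rewrite mulr_ge0 ?sqr_ge0.
have mdev : measurable_fun [set: T]
    (fun w => \int[mu]_(t in I) (sqr_deviation X Xs w t)%:E)%E.
  exact: measurable_integrated_sqr_deviation.
have dev0 w : (0 <= \int[mu]_(t in I) (sqr_deviation X Xs w t)%:E)%E.
  by apply: integral_ge0 => t _; rewrite lee_fin sqr_deviation_ge0.
rewrite ge0_integralD//; last 2 first.
- by move=> w _; rewrite mule_ge0.
- exact: emeasurable_funM.
have -> : (\int[P]_w c2%:E = c2%:E)%E.
  rewrite (integral_cst P measurableT) -[RHS]mule1; congr (_ * _)%E.
  exact: probability_setT.
rewrite ge0_integralZl_EFin// EFinD leeD2r//.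
apply: (@le_trans _ _ (c1%:E * (4 / (n%:R * h))%:E)%E).
  by apply: lee_wpmul2l; rewrite ?lee_fin// integral_integrated_sqr_deviation.
(* The powers of [h] cancel, and [256 = 4 * 4^2 * 4]. *)
rewrite -EFinM lee_fin le_eqVlt; apply/orP; left; apply/eqP.
rewrite /c1; field.
by rewrite pnatr_eq0 -lt0n n_gt0 !gt_eqF.
Qed.

End risk_bound.

Lemma bias_rate {R : realType} (eta beta b : R) n :
  0 < eta -> 0 < ln (n%:R : R) ->
  (b * bandwidth eta n `^ (1 + beta)) ^+ 2 =
  b ^+ 2 * eta `^ (- (1 + beta)) * ln n%:R `^ (- beta - 1).
Proof.
move=> eta0 l0; rewrite exprMn -mulrA; congr (_ * _).
rewrite -powR_mulrn ?powR_ge0// -powRrM powR_bandwidth//.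
by congr (_ `^ _ * _ `^ _); field.
Qed.

(** * Behaviour of the tuning parameters for large [n] *)

Section tuning.
Context {R : realType} (beta Lambda Sigma eta : R) (m : R^nat).
Hypothesis beta_gt0 : 0 < beta.
Hypotheses (Sigma_gt0 : 0 < Sigma) (eta_bounds : 0 < eta < Sigma ^- 2).
Hypothesis m_dvg : m @ \oo --> +oo.
Hypothesis m_slow : (m : nat -> R^o) =o_\oo (fun n : nat => ln n%:R : R^o).

(* A lower bound for [|phi_X t|] on [|t| <= h^-1], where [q = h^-2]. *)
Definition modulus_floor (q : R) : R := expR (- (2 * Lambda + 2^-1 * Sigma ^+ 2 * q)).

Lemma near_tuning : \forall n \near \oo,
  [/\ (0 < n)%N, 0 < ln (n%:R : R), 1 <= trunc_level eta m n,
      trunc_level eta m n <= eta * ln n%:R ^+ 2 &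
      expR (- trunc_level eta m n) <= modulus_floor (eta * ln n%:R)].
Proof.
have /andP[eta0 _] := eta_bounds.
have mge (a : R) : \forall n \near \oo, a <= m n.
  by move/cvgryPge : m_dvg; exact.
have ml : \forall n \near \oo, `|m n| <= 1 * `|ln (n%:R : R)|.
  by move/eqoP : m_slow => /(_ 1 ltr01).
near=> n.
have n0 : (0 < n)%N by near: n; exact: nbhs_infty_gt.
have l1 : 1 <= ln (n%:R : R) by near: n; exact: near_ln_ge.
(* With [q = eta * ln n], this gives [1 <= q], hence [M >= 1] once [m n >= 1]. The next bound gives
   [4 * Lambda <= Sigma^2 * q], so the exponent of the floor is at most [Sigma^2 * q], and that is
   at most [M] once [m n >= Sigma^2]. *)
have l2 : eta^-1 * 1 <= ln (n%:R : R) by near: n; exact: near_ln_ge.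
have l3 : (eta^-1 * (4 * Lambda / Sigma ^+ 2)) <= ln (n%:R : R).
  by near: n; exact: near_ln_ge.
have m1 : 1 <= m n by near: n; exact: mge.
have m2 : Sigma ^+ 2 <= m n by near: n; exact: mge.
have m3 : m n <= ln (n%:R : R).
  have l0 : 0 <= ln (n%:R : R) by lra.
  rewrite -(ger0_norm l0) -[leRHS]mul1r (le_trans (ler_norm _))//.
  by near: n.
set l := ln (n%:R : R) in l1 l2 l3 m3 *.
have l0 : 0 < l by lra.
have q0 : 0 < eta * l by rewrite mulr_gt0.
rewrite /trunc_level bandwidth_exprN2//.
rewrite ler_pdivrMl// in l2; rewrite ler_pdivrMl// in l3.
set q := eta * l in q0 l2 l3 *.
have S2 : 0 < Sigma ^+ 2 by rewrite exprn_gt0.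
rewrite ler_pdivrMr// in l3.
split => //.
- by have : 1 * 1 <= m n * q; [rewrite ler_pM//; lra|lra].
- have -> : eta * l ^+ 2 = l * q by rewrite /q; ring.
  by rewrite ler_pM2r.
- rewrite /modulus_floor ler_expR lerN2.
  have : Sigma ^+ 2 * q <= m n * q by rewrite ler_pM2r.
  move: l3; rewrite mulrC; lra.
Unshelve. all: by end_near. Qed.

(** Here [l] is [ln n]. The squared floor costs [expR (4 * Lambda + Sigma^2 * eta * l)], so dividing
    by [n = expR l] leaves the decay [expR (- (d * l))] with [d > 0]. The exponent [beta + 5] is 4,
    for the [l ^ 4] coming from [M ^ 2], plus [beta + 1] for the target rate. *)
Lemma stochastic_rate (l M : R) : 0 < l -> 0 <= M -> M <= eta * l ^+ 2 ->
  M ^+ 2 / (modulus_floor (eta * l) ^+ 2 * expR l) <=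
  eta ^+ 2 * expR (4 * Lambda) *
    ((beta + 5) / (1 - Sigma ^+ 2 * eta)) `^ (beta + 5) * l `^ (- beta - 1).
Proof.
move=> l0 M0 Ml.
have /andP[eta0 etaS] := eta_bounds.
have S2 : 0 < Sigma ^+ 2 by rewrite exprn_gt0.
set d := 1 - Sigma ^+ 2 * eta.
have d0 : 0 < d.
  rewrite /d.
  have <- : Sigma ^+ 2 * Sigma ^- 2 = 1 by rewrite divff// gt_eqF.
  by rewrite -mulrBr mulr_gt0// subr_gt0.
have -> : (modulus_floor (eta * l) ^+ 2 * expR l)^-1 =
    expR (4 * Lambda) * expR (- (d * l)).
  rewrite /modulus_floor -expRM_natl -!expRD -expRN; congr expR.
  by rewrite /d; field.
have b5 : 0 < beta + 5 by rewrite addr_gt0.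
have lp := powR_le_expR b5 d0 (ltW l0).
have {}lp : l ^+ 4 * expR (- (d * l)) <=
    ((beta + 5) / d) `^ (beta + 5) * l `^ (- beta - 1).
  rewrite expRN ler_pdivrMr ?expR_gt0//.
  have -> : l ^+ 4 = l `^ (beta + 5) * l `^ (- beta - 1).
    rewrite -powRD; last by rewrite (gt_eqF l0) implybT.
    have -> : beta + 5 + (- beta - 1) = 4%:R by ring.
    by rewrite powR_mulrn// ltW.
  rewrite mulrAC; apply: ler_wpM2r; first exact: powR_ge0.
  exact: lp.
apply: (@le_trans _ _ ((eta * l ^+ 2) ^+ 2 * (expR (4 * Lambda) * expR (- (d * l))))).
  apply: ler_wpM2r; first by rewrite mulr_ge0 ?expR_ge0.
  by rewrite ler_pXn2r ?nnegrE ?(le_trans M0 Ml).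
have -> : (eta * l ^+ 2) ^+ 2 * (expR (4 * Lambda) * expR (- (d * l))) =
   eta ^+ 2 * expR (4 * Lambda) * (l ^+ 4 * expR (- (d * l))) by ring.
rewrite -[leRHS]mulrA; apply: ler_wpM2l => //.
by rewrite mulr_ge0 ?expR_ge0 ?sqr_ge0.
Qed.

End tuning.

(** From [Re phi_f >= -1] the jumps lower the exponent by at most [2 * lambda]; the Gaussian part is
    largest at the edge of the window. *)
Lemma modulus_floor_le {R : realType} (Lambda Sigma : R) (h gamma sigma lambda : R)
    (rho f : R -> R) (t : R) :
  0 < h -> 0 < sigma <= Sigma -> 0 < lambda <= Lambda ->
  (forall x, rho x = lambda * f x) -> prob_density f -> `|t| <= h^-1 ->
  modulus_floor Lambda Sigma (h ^- 2) <= cmod (phi_levy gamma sigma rho t).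
Proof.
move=> h0 /andP[s0 sS] /andP[l0 lL] rhoE fd th.
rewrite (cmod_phi_levy _ _ _ rhoE fd) /modulus_floor ler_expR.
have /ler_normlP[p1 _] := normr_Re_phi_density_le1 t fd.
have p2 : lambda * - complex.Re (phi_density f t) <= lambda * 1 by rewrite ler_pM2l.
have t2 : t ^+ 2 <= h ^- 2.
  by rewrite -exprVn -[leLHS]real_normK ?num_real// ler_pXn2r ?nnegrE// invr_ge0 ltW.
have st : sigma ^+ 2 * t ^+ 2 <= Sigma ^+ 2 * h ^- 2.
  by rewrite ler_pM ?sqr_ge0// ler_pXn2r ?nnegrE// ltW// (lt_le_trans s0).
move: p2; rewrite mulr1 mulrN; set a := lambda * _ => p2.
rewrite -[_ * sigma ^+ 2 * _]mulrA -[_ * Sigma ^+ 2 * _]mulrA.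
lra.
Qed.

Theorem theorem2p2 (R : realType) (beta L Lambda K Sigma Gamma : R)
  (beta_gt0 : 0 < beta) (L_gt0 : 0 < L) (Lambda_gt0 : 0 < Lambda)
  (K_gt0 : 0 < K) (Sigma_gt0 : 0 < Sigma) (Gamma_gt0 : 0 < Gamma)
  (u : R -> R)
  (u_cont : continuous u)
  (u_supp : forall t, 1 < `|t| -> u t = 0)
  (u_int : \int[@lebesgue_measure R]_(t in `[-1, 1]) u t = -1)
  (u_int2 : \int[@lebesgue_measure R]_(t in `[-1, 1]) (t ^+ 2 * u t) = 0)
  (u_bigO : (u : R -> R^o) =O_ (0 : R) (fun t : R => `|t| `^ beta : R^o))
  (eta : R) (eta_bounds : 0 < eta < Sigma ^- 2)
  (m : R^nat)
  (m_dvg : m @ \oo --> +oo)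
  (m_slow : (m : nat -> R^o) =o_\oo (fun n : nat => ln n%:R : R^o))
  (M_gt0 : forall n, (1 < n)%N -> 0 < trunc_level eta m n) :
  exists (A : R) (n0 : nat), 0 < A /\
    forall n, (n0 <= n)%N ->
    forall (gamma sigma : R) (rho : R -> R),
      `|gamma| <= Gamma -> 0 < sigma <= Sigma ->
      W beta L Lambda K rho ->
    forall (d : measure_display) (T : measurableType d) (P : probability T R)
      (X : {RV P >-> R}) (Xs : 'I_n -> {RV P >-> R}),
      (forall t, char_fun X t = phi_levy gamma sigma rho t) ->
      iid_copies X Xs ->
      ('E_P[fun w => ((lambda_est u eta m (fun j => Xs j w) - intensity rho) ^+ 2)%R]
         <= (A * ln n%:R `^ (- beta - 1))%:E)%E.
Proof.
have [C C0 uC] := kernel_bound beta_gt0 u_cont u_supp u_bigO.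
have uC1 s : `|u s| <= C.
  have [s1|s1] := ltP 1 `|s|; first by rewrite u_supp// normr0 ltW.
  apply: le_trans (uC s) _; rewrite -[leRHS]mulr1 ler_pM2l//.
  have <- : 1 `^ beta = 1 :> R by rewrite powR1.
  by rewrite ge0_ler_powR ?nnegrE// ltW.
have /andP[eta0 _] := eta_bounds.
(* The threshold [n0] is fixed before the law is introduced, which gives uniformity. *)
have [n0 _ tuned] := near_tuning Lambda Sigma_gt0 eta_bounds m_dvg m_slow.
(* [A1] and [A2] are the coefficients of [ln n ^ (- beta - 1)] in the stochastic and the bias terms
   of the risk bound. *)
set A1 := 256 * C ^+ 2 * (eta ^+ 2 * expR (4 * Lambda) *
  ((beta + 5) / (1 - Sigma ^+ 2 * eta)) `^ (beta + 5)).
set A2 := 2 * ((Lambda * C * L) ^+ 2 * eta `^ (- (1 + beta))).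
have A10 : 0 <= A1.
  apply: mulr_ge0; first by rewrite mulr_ge0 ?sqr_ge0.
  by rewrite mulr_ge0 ?powR_ge0// mulr_ge0 ?sqr_ge0 ?expR_ge0.
have A20 : 0 < A2.
  by rewrite /A2 mulr_gt0// mulr_gt0 ?powR_gt0// exprn_gt0// !mulr_gt0.
exists (A1 + A2), n0; split; first by rewrite ltr_wpDl.
move=> n n0n gamma sigma rho _ sigma_bounds [lambda [f [rhoE fd _ fL lambda_bounds]]].
move=> d T P X Xs charX iidX.
have [n_gt0 l0 M1 Ml Mfloor] := tuned n n0n.
have q0 : 0 < eta * ln n%:R by rewrite mulr_gt0.
have h0 := bandwidth_gt0 q0.
have floor t : `|t| <= (bandwidth eta n)^-1 ->
    modulus_floor Lambda Sigma (eta * ln n%:R) <=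
    cmod (phi_levy gamma sigma rho t).
  rewrite -(bandwidth_exprN2 q0); exact: modulus_floor_le h0 _ lambda_bounds rhoE fd.
apply: le_trans (risk_le u_cont C0 uC uC1 u_int u_int2 rhoE fd fL
  lambda_bounds h0 M1 (expR_gt0 _) floor Mfloor charX iidX n_gt0) _.
rewrite lee_fin [leRHS]mulrDl lerD//.
- rewrite /A1 -[leLHS]mulrA -[leLHS]mulrA -[leRHS]mulrA.
  have := stochastic_rate Lambda beta_gt0 Sigma_gt0 eta_bounds l0 (le_trans ler01 M1) Ml.
  rewrite [expR (ln _)]lnK ?posrE ?ltr0n// => rate.
  rewrite mulrA; apply: ler_wpM2l; first by rewrite mulr_ge0 ?sqr_ge0.
  exact: rate.
- have -> : Lambda * (C * bandwidth eta n `^ (1 + beta) * L) =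
      Lambda * C * L * bandwidth eta n `^ (1 + beta) by ring.
  by rewrite bias_rate// /A2 mulrA.
Qed.
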